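(* For all integers $s \ge 0$ and $k > 1$, the optimal threshold factor $R_{s,k,2}$ for explicit $s$-stage, $k$-step, second order general linear methods is $$R_{s,k,2}=\frac{(k-2)s+\sqrt{(k-2)^2s^2+4s(s-1)(k-1)}}{2(k-1)}.$$
   Context: Stability functions. An explicit $s$-stage, $k$-step general linear method applied to the scalar linear ODE $u'(t)=\lambda u(t)$ with step size $\Delta t$ results in an iteration $$u_{n+1}=\psi_1(z)u_n+\psi_2(z)u_{n-1}+\cdots+\psi_k(z)u_{n-k+1},\qquad z=\Delta t\,\lambda,$$ where $\psi_1,\dots,\psi_k$ are polynomials with real coefficients and degree at most $s$ (the stability functions of the method). Order conditions. Only the order conditions for linear problems are imposed. The tuple $(\psi_1,\dots,\psi_k)$ satisfies the order conditions up to order $p$ if $$\sum_{i=1}^k \psi_i(z)\,e^{(k-i)z}=e^{kz}+O(z^{p+1})\quad\text{as } z\to 0 .$$ For $p=2$ this means $$\sum_{i=1}^k\psi_i(0)=1,\qquad \sum_{i=1}^k\bigl(\psi_i'(0)+(k-i)\psi_i(0)\bigr)=k,\qquad \sum_{i=1}^k\bigl(\psi_i''(0)+2(k-i)\psi_i'(0)+(k-i)^2\psi_i(0)\bigr)=k^2.$$ Let $\Pi_{s,k,p}$ denote the set of all $k$-tuples $(\psi_1,\dots,\psi_k)$ of real polynomials of degree at most $s$ satisfying the order conditions up to order $p$. Radius of absolute monotonicity. For a polynomial $\psi$, $$R(\psi)=\sup\{r\ge 0 : \psi^{(j)}(z)\ge 0 \text{ for all } z\in[-r,0] \text{ and all }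 j\ge 0\},$$ where $\psi^{(j)}$ is the $j$th derivative ($\psi^{(0)}=\psi$); the value $+\infty$ is allowed. Threshold factor. For $(\psi_1,\dots,\psi_k)$ set $\overline{R}(\psi_1,\dots,\psi_k)=\min_{1\le i\le k}R(\psi_i)$. Optimal threshold factor. $$R_{s,k,p}=\sup\{\overline{R}(\psi_1,\dots,\psi_k) : (\psi_1,\dots,\psi_k)\in\Pi_{s,k,p}\}.$$ Convention: in the definitions of $R(\psi)$ and $R_{s,k,p}$, the supremum of the empty set is taken to be $0$. *)

(* Defs.v *)
From mathcomp Require Import all_boot all_order all_algebra.
From mathcomp Require Import all_classical all_reals all_analysis.

Set Implicit Arguments.
Unset Strict Implicit.
Unset Printing Implicit Defensive.

Import Order.TTheory GRing.Theory Num.Theory.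
Import numFieldNormedType.Exports.
Local Open Scope classical_set_scope.
Local Open Scope ring_scope.

Section threshold.
Context {R : realType}.

(* [ereal_sup set0] is -oo; here the supremum of the empty set is 0. *)
Definition ereal_sup_or0 (A : set (\bar R)) : \bar R :=
  if `[< A = set0 >] then 0%E else ereal_sup A.

(* Stability functions are indexed from 0: [psi i] stands for psi_{i+1}, hence
   the exponent k - (i+1), a natural subtraction that never truncates. *)
Definition order_conditions (k p : nat) (psi : 'I_k -> {poly R}) : Prop :=
  (fun z : R => \sum_(i < k) (psi i).[z] * expR ((k - i.+1)%:R * z))
  = (fun z : R => expR (k%:R * z)) +O_ (0 : R) (fun z : R => z ^+ p.+1).

(* [size q <= s.+1] says that q has degree at most s. *)
Definition stability_tuples (s k p : nat) : set ('I_k -> {poly R}) :=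
  [set psi : 'I_k -> {poly R} | (forall i, (size (psi i) <= s.+1)%N)
    /\ order_conditions p psi].
Arguments stability_tuples : clear implicits.

Definition abs_monotonicity_radius (q : {poly R}) : \bar R :=
  ereal_sup_or0 [set r%:E | r in [set r : R | 0 <= r /\
    forall z : R, - r <= z <= 0 -> forall j : nat, 0 <= (q^`(j)).[z]]].

(* +oo is only the neutral element of the minimum, irrelevant for 0 < k. *)
Definition threshold_factor (k : nat) (psi : 'I_k -> {poly R}) : \bar R :=
  \big[Order.min/+oo%E]_(i < k) abs_monotonicity_radius (psi i).

Definition optimal_threshold_factor (s k p : nat) : \bar R :=
  ereal_sup_or0 [set threshold_factor psi | psi in stability_tuples s k p].

End threshold.

Arguments optimal_threshold_factor : clear implicits.

(* Main.v *)
Require Import Defs.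
From mathcomp Require Import all_boot all_order all_algebra.
From mathcomp Require Import all_classical all_reals all_analysis.
From mathcomp Require Import ring lra.

(** Absolute monotonicity turns the threshold problem into a moment problem on
finitely many points, whose optimum is certified by one linear functional.

If all derivatives of a polynomial of degree at most s are nonnegative at -r,
with r > 0, then its Taylor expansion at -r writes it as a combination of the
powers (1 + z/r)^j, j <= s, with nonnegative coefficients
([abs_monotone_expansion]). With psi_1, ..., psi_k numbered from 1, let a = k - i
be the exponent that goes with psi_i in the order conditions. A stability tuple
thus becomes a family of nonnegative weights on the pairs (a, j) with a < k and
j <= s, and the order conditions prescribe three moments of it: the total mass
is 1, the mean of
  B = j/r + a  is  k,  and the mean of  C = j(j-1)/r^2 + 2aj/r + a^2  is  k^2
([order_conditions2P]). Hence the mean of C - kB is zero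
([order_conditions2_moment_defect]).

Upper bound. Let T(r) = (k-1)r^2 - (k-2)sr - s(s-1), whose larger root is the
announced value M. If r > M then T(r) > 0, and C - kB is negative at every pair
except (0, 0), where it vanishes ([moment_defect_neg]). All the mass then sits
at (0, 0), and the mean of B is 0 instead of k, a contradiction. So an
admissible r satisfies T(r) <= 0 ([threshold_poly_le0]), that is r <= M.

Lower bound. At r = M the functional C - kB vanishes at (k-1, s) as well, which
leaves room for weights on these two points: psi_1 = w(1 + z/M)^s and
psi_k = 1 - w, the others being zero. The mean of B fixes w, the vanishing of
T(M) yields the last moment ([extremal_order]), and M <= s gives w <= 1. When
M = 0 there is nothing to construct, since threshold factors are nonnegative
and the supremum of the empty set is 0. *)

Import Order.TTheory GRing.Theory Num.Theory.
Import numFieldNormedType.Exports.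
Local Open Scope ring_scope.

(** * Order conditions as identities between coefficients *)

Section order_two.
Context {R : realType}.
Implicit Types (x a : R) (p : {poly R}).

Lemma bigO_mono_exP (f : R -> R) (n : nat) :
  (f =O_ (0 : R) (fun z : R => z ^+ n)) <->
  exists2 C, 0 < C & \forall z \near (0 : R), `|f z| <= C * `|z| ^+ n.
Proof.
split=> [/eqO_exP[C C0 fC]|[C C0 fC]].
- by exists C => //; apply: filterS fC => z; rewrite normrX.
- by apply/eqO_exP; exists C => //; apply: filterS fC => z; rewrite normrX.
Qed.

Lemma bigO_monoD n (f g : R -> R) :
  (f =O_ (0 : R) (fun z : R => z ^+ n)) ->
  (g =O_ (0 : R) (fun z : R => z ^+ n)) ->
  (fun z => f z + g z) =O_ (0 : R) (fun z : R => z ^+ n).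
Proof.
move=> /bigO_mono_exP[C C0 fC] /bigO_mono_exP[D D0 gD].
apply/bigO_mono_exP; exists (C + D); first exact: addr_gt0.
near=> z; rewrite mulrDl; apply: le_trans (ler_normD _ _) _.
by apply: lerD; near: z.
Unshelve. all: by end_near. Qed.

Lemma bigO_mono_sum n (I : finType) (F : I -> R -> R) :
  (forall i, F i =O_ (0 : R) (fun z : R => z ^+ n)) ->
  (fun z => \sum_i F i z) =O_ (0 : R) (fun z : R => z ^+ n).
Proof.
move=> FO.
have -> : (fun z => \sum_i F i z) = \sum_i F i.
  by apply/funext => z; rewrite fct_sumE.
apply: (big_ind (fun f : R -> R => f =O_ (0 : R) (fun z : R => z ^+ n))).
- apply/bigO_mono_exP; exists 1 => //; near=> z.
  by rewrite normr0 mul1r exprn_ge0.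
- exact: bigO_monoD.
- by move=> i _; exact: FO.
Unshelve. all: by end_near. Qed.

Lemma bigO_hornerM n (p : {poly R}) (f : R -> R) :
  (f =O_ (0 : R) (fun z : R => z ^+ n)) ->
  (fun z => p.[z] * f z) =O_ (0 : R) (fun z : R => z ^+ n).
Proof.
move=> /bigO_mono_exP[C C0 fC]; apply/bigO_mono_exP.
exists ((`|p.[0]| + 1) * C); first by rewrite mulr_gt0 ?ltr_wpDl.
have : \forall z \near (0 : R), `|p.[z]| <= `|p.[0]| + 1.
  have pc : (horner p z @[z --> (0 : R)] --> p.[0])%classic.
    exact: continuous_horner.
  apply: (@cvgr_norm_le _ _ _ (nbhs (0 : R)) _ (horner p) p.[0] pc).
  by rewrite ltrDl.
move=> pC; near=> z; rewrite normrM -mulrA; apply: ler_pM => //; by near: z.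
Unshelve. all: by end_near. Qed.

Lemma bigO_monoB n (f g : R -> R) :
  (f =O_ (0 : R) (fun z : R => z ^+ n)) ->
  (g =O_ (0 : R) (fun z : R => z ^+ n)) ->
  (fun z => f z - g z) =O_ (0 : R) (fun z : R => z ^+ n).
Proof.
move=> fO gO; have := bigO_monoD _ _ _ fO (bigO_hornerM n (-1) _ gO).
by under eq_fun do rewrite hornerN hornerC mulN1r.
Qed.

(** The order conditions become algebraic through this. Low-order coefficients
are removed one at a time: p.[0] = 0, so p is z times a polynomial, which is
O(z^(n-1)) by cancelling z; at z = 0 the bound comes from continuity. *)
Lemma bigO_hornerP n (p : {poly R}) :
  ((fun z => p.[z]) =O_ (0 : R) (fun z : R => z ^+ n)) <->
  forall i, (i < n)%N -> p`_i = 0.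
Proof.
split; last first.
  move=> p0; rewrite -[p](poly_take_drop n).
  have -> : take_poly n p = 0.
    by apply/polyP => i; rewrite coef_take_poly coef0; case: ifP => // /p0.
  have -> : (fun z => (0 + drop_poly n p * 'X^n).[z])
          = (fun z => (drop_poly n p).[z] * z ^+ n).
    by apply/funext => z; rewrite !hornerE.
  apply: bigO_hornerM; apply/bigO_mono_exP; exists 1 => //.
  by near=> z; rewrite mul1r normrX.
elim: n p => [//|n IHn] p /bigO_mono_exP[C C0 pC].
have p0 : p.[0] = 0.
  apply/eqP; rewrite -normr_le0 (le_trans (nbhs_singleton pC))//.
  by rewrite normr0 expr0n mulr0.
have /factor_theorem [q] : root p 0 by rewrite /root p0.
rewrite subr0 => pE.
suff qO i : (i < n)%N -> q`_i = 0.
  by case=> [_|i]; [rewrite -horner_coef0 | rewrite pE coefMX; exact: qO].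
apply: IHn; apply/bigO_mono_exP; exists C => //.
have qC : \forall z \near (0 : R)^'%classic, `|q.[z]| <= C * `|z| ^+ n.
  near=> z.
  have z0 : 0 < `|z| by rewrite normr_gt0; near: z; exact: nbhs_dnbhs_neq.
  rewrite -(ler_pM2r z0) -normrM -mulrA -exprSr.
  have -> : q.[z] * z = p.[z] by rewrite pE !hornerE.
  by near: z; exact: nbhs_dnbhs.
have q0 : `|q.[0]| <= `|(C *: 'X^n).[0]|.
  apply: (@ler_cvg_to _ (0 : R)^'%classic _ _ (fun z => `|q.[z]|)
            (fun z => `|(C *: 'X^n).[z]|)).
  - by apply: cvg_norm; apply: cvg_within_filter; exact: continuous_horner.
  - by apply: cvg_norm; apply: cvg_within_filter; exact: continuous_horner.
  - near=> z; rewrite !hornerE normrM normrX gtr0_norm//.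
    by near: z.
rewrite !hornerE normrM normrX gtr0_norm// in q0.
near=> z; have [->//|] := eqVneq z 0.
by near: z; exact: qC.
Unshelve. all: by end_near. Qed.

(** The upper half is [1 - x <= expR (- x)] inverted:
[expR x <= 1 / (1 - x)], and [1 / (1 - x) - 1 - x = x ^+ 2 / (1 - x)]. *)
Lemma expR_taylor1 x : `|x| <= 1 / 2 -> `|expR x - (1 + x)| <= 2 * x ^+ 2.
Proof.
move=> xh; have /andP[x1 x2] : - (1/2) <= x <= 1/2 by rewrite -ler_norml.
rewrite ger0_norm ?subr_ge0 ?expR_ge1Dx//.
have e0 := expR_gt0 x.
have h := expR_ge1Dx (- x).
have : expR x * expR (-x) = 1 by rewrite expRxMexpNx_1.
nra.
Qed.

Definition exp_taylor2 (a : R) : {poly R} :=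
  1 + a *: 'X + (a ^+ 2 / 2) *: 'X^2.

Lemma exp_taylor2_horner a x :
  (exp_taylor2 a).[x] = 1 + a * x + a ^+ 2 / 2 * x ^+ 2.
Proof. by rewrite /exp_taylor2 !hornerE. Qed.

(** Mean value theorem: the derivative of the remainder of order two is the
remainder of order one. *)
Lemma expR_taylor2 x : `|x| <= 1 / 2 ->
  `|expR x - (exp_taylor2 1).[x]| <= 2 * `|x| ^+ 3.
Proof.
move=> xh.
have dg (y : R) : is_derive y (1 : R)
    (expR - horner (exp_taylor2 1) : R -> R) (expR y - (1 + y)).
  have -> : 1 + y = (exp_taylor2 1)^`().[y].
    rewrite /exp_taylor2 !derivD !derivZ derivXn derivX derivC !hornerE /=.
    by field.
  exact: is_deriveB.
have cg : continuous (expR - horner (exp_taylor2 1) : R -> R).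
  move=> y; apply: cvgB; [exact: continuous_expR|exact: continuous_horner].
have g0 : (expR - horner (exp_taylor2 1)) 0 = 0 :> R.
  by rewrite !fctE exp_taylor2_horner expR0; ring.
have key c : `|c| <= `|x| -> `|expR c - (1 + c)| * `|x| <= 2 * `|x| ^+ 3.
  move=> cx; rewrite exprSr mulrA ler_wpM2r//.
  apply: le_trans (expR_taylor1 c _) _; first exact: le_trans xh.
  by rewrite ler_pM2l// -real_normK ?num_real// lerXn2r ?nnegrE.
have [x0|x0] := leP 0 x.
  have [|c] := MVT_segment x0 (fun y _ => dg y).
    exact: continuous_subspaceT.
  rewrite g0 !subr0 !fctE in_itv/= => /andP[c0 cx] ->.
  by rewrite normrM; apply: key; rewrite !ger0_norm.
have [|c] := MVT_segment (ltW x0) (fun y _ => dg y).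
  exact: continuous_subspaceT.
rewrite g0 !sub0r !fctE in_itv/= => /andP[c0 cx].
rewrite -normrN => ->.
by rewrite normrM normrN; apply: key; rewrite !ler0_norm// ?lerN2 // ltW.
Qed.

Lemma expR_taylor2_bigO a :
  (fun z => expR (a * z) - (exp_taylor2 a).[z]) =O_ (0 : R) (fun z : R => z ^+ 3).
Proof.
apply/bigO_mono_exP; exists (2 * `|a| ^+ 3 + 1).
  by rewrite ltr_wpDl ?mulr_ge0.
near=> z.
have -> : (exp_taylor2 a).[z] = (exp_taylor2 1).[a * z].
  by rewrite !exp_taylor2_horner; ring.
apply: le_trans (expR_taylor2 _ _) _.
  rewrite normrM.
  have : `|z| <= (`|a| + 1)^-1 / 2.
    near: z; apply: (@nbhs0_le R R); rewrite divr_gt0 ?invr_gt0 ?ltr_wpDl//.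
  have a1 : 0 < `|a| + 1 by rewrite ltr_wpDl.
  move=> zl; have : (`|a| + 1) * `|z| <= 1 / 2.
    apply: le_trans (ler_wpM2l (ltW a1) zl) _.
    by rewrite mulrA mulfV ?gt_eqF.
  by apply: le_trans; rewrite ler_wpM2r// lerDl.
rewrite normrM exprMn mulrA ler_wpM2r ?exprn_ge0//.
by rewrite lerDl.
Unshelve. all: by end_near. Qed.

Lemma coef_mul_exp_taylor2 a p :
  [/\ (p * exp_taylor2 a)`_0 = p`_0, (p * exp_taylor2 a)`_1 = p`_1 + a * p`_0 &
      (p * exp_taylor2 a)`_2 = p`_2 + a * p`_1 + a ^+ 2 / 2 * p`_0].
Proof.
rewrite /exp_taylor2 2!mulrDr mulr1 -!scalerAr !coefD !coefZ !coefMX !coefMXn /=.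
by rewrite !mulr0 !addr0; split.
Qed.

Lemma coef_exp_taylor2 a :
  [/\ (exp_taylor2 a)`_0 = 1, (exp_taylor2 a)`_1 = a &
      (exp_taylor2 a)`_2 = a ^+ 2 / 2].
Proof.
have := coef_mul_exp_taylor2 a 1; rewrite mul1r !coef1 /= => -[-> -> ->].
by split => //; ring.
Qed.

(** Replacing every exponential by its Taylor polynomial of degree two changes
the defect of order by O(z^3), so only the coefficients 0, 1 and 2 of a
polynomial remain to be compared. *)
Lemma order_conditions2P (k : nat) (psi : 'I_k -> {poly R}) :
  order_conditions 2 psi <->
  forall j, (j < 3)%N ->
    (\sum_i psi i * exp_taylor2 (k - i.+1)%:R)`_j = (exp_taylor2 k%:R)`_j.
Proof.
set P := \sum_i _.
apply: (@iff_trans _ (forall j, (j < 3)%N ->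
    (P - exp_taylor2 k%:R)`_j = 0)); last first.
  split=> h j /h; rewrite coefB; last by move=> ->; rewrite subrr.
  by move=> /eqP; rewrite subr_eq0 => /eqP.
apply: iff_trans (bigO_hornerP 3 _).
pose E (a z : R) := expR (a * z) - (exp_taylor2 a).[z].
have EO : (fun z => \sum_i (psi i).[z] * E (k - i.+1)%:R z - E k%:R z)
    =O_ (0 : R) (fun z : R => z ^+ 3).
  apply: bigO_monoB; last exact: expR_taylor2_bigO.
  apply: bigO_mono_sum => i; apply: bigO_hornerM; exact: expR_taylor2_bigO.
have split_remainder z : \sum_i (psi i).[z] * expR ((k - i.+1)%:R * z)
    - expR (k%:R * z) = (P - exp_taylor2 k%:R).[z]
      + (\sum_i (psi i).[z] * E (k - i.+1)%:R z - E k%:R z).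
  rewrite /E; under [X in _ + (X - _)]eq_bigr do rewrite mulrBr.
  rewrite sumrB hornerD hornerN horner_sum.
  under [X in (X - _) + _]eq_bigr do rewrite hornerM.
  by ring.
rewrite /order_conditions.
apply: (@iff_trans _ ((fun z => \sum_i (psi i).[z] * expR ((k - i.+1)%:R * z)
    - expR (k%:R * z)) =O_ (0 : R) (fun z : R => z ^+ 3))).
  apply: iff_trans (eqaddOP _ _ _ _) _.
  exact: iff_sym (eqOP _ _ _).
split=> h.
- have := bigO_monoB _ _ _ h EO.
  by under eq_fun do rewrite split_remainder addrK.
- have := bigO_monoD _ _ _ h EO.
  by under eq_fun do rewrite -split_remainder.
Qed.

End order_two.

(** * Absolutely monotone polynomials *)

Section absolute_monotonicity.
Context {R : realType}.
Implicit Types (r a c : R) (p q : {poly R}).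

Definition shifted_power c n : {poly R} := (1 + c *: 'X) ^+ n.

Lemma shifted_power_coef c n :
  [/\ (shifted_power c n)`_0 = 1, (shifted_power c n)`_1 = n%:R * c &
      (shifted_power c n)`_2 = n%:R * (n%:R - 1) / 2 * c ^+ 2].
Proof.
elim: n => [|n [h0 h1 h2]].
  by rewrite /shifted_power expr0 !coef1 /= !mul0r.
have rec i : (shifted_power c n.+1)`_i = (shifted_power c n)`_i
    + (if i is i'.+1 then c * (shifted_power c n)`_i' else 0).
  rewrite {1}/shifted_power exprS mulrDl mul1r -scalerAl coefD coefZ coefXM.
  by case: i => [|i]//=; rewrite mulr0.
by rewrite !rec h0 h1 h2 addr0 -natr1; split=> //; field.
Qed.

Lemma shifted_power_size c n : (size (shifted_power c n) <= n.+1)%N.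
Proof.
apply: leq_trans (size_poly_exp_leq _ _) _; rewrite ltnS.
have : (size (1 + c *: 'X : {poly R})%R <= 2)%N.
  rewrite (leq_trans (size_polyD _ _))// geq_max size_poly1/=.
  by rewrite (leq_trans (size_scale_leq _ _))// size_polyX.
by case: size => [|[|[|//]]] //= _; rewrite ?mul0n ?mul1n.
Qed.

Lemma derivn_shifted_power (c : R) n j : 0 <= c ->
  exists2 a : R, 0 <= a &
    exists m, (shifted_power c n)^`(j) = a *: shifted_power c m.
Proof.
move=> c0; elim: j => [|j [a a0 [m IH]]].
  by exists 1 => //; exists n; rewrite derivn0 scale1r.
exists (a * (c *+ m)); first by rewrite mulr_ge0// mulrn_wge0.
exists m.-1; rewrite derivnS IH derivZ /shifted_power deriv_exp.
rewrite derivD derivZ derivX derivC add0r -scalerAl mul1r.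
by rewrite -scalerA scalerMnl.
Qed.

Lemma horner_inj p q : (forall z, p.[z] = q.[z]) -> p = q.
Proof.
move=> pq; apply/eqP; rewrite -subr_eq0; apply/eqP.
apply: (@roots_geq_poly_eq0 _ _ [seq i%:R | i <- iota 0 (size (p - q))]).
- by apply/allP => x _; rewrite /root !hornerE pq subrr.
- rewrite map_inj_uniq ?iota_uniq// => i j /eqP.
  by rewrite eqr_nat => /eqP.
- by rewrite size_map size_iota.
Qed.

(** The j-th coefficient is r^j times the Taylor coefficient of p at -r, because
(z + r)^j = r^j (1 + z/r)^j. *)
Lemma abs_monotone_expansion s p r : 0 < r -> (size p <= s.+1)%N ->
  (forall j, 0 <= (p^`(j)).[- r]) ->
  exists2 g : 'I_s.+1 -> R, forall j, 0 <= g j &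
    p = \sum_j g j *: shifted_power r^-1 j.
Proof.
move=> r0 sp p0; exists (fun j => p^`N(j).[- r] * r ^+ j) => [j|].
  apply: mulr_ge0; last by rewrite exprn_ge0 ?ltW.
  have := p0 j; rewrite nderivn_def hornerMn.
  by rewrite pmulrn_lge0 ?fact_gt0.
apply: horner_inj => z; rewrite horner_sum.
rewrite -[z in LHS](addKr r).
rewrite (nderiv_taylor_wide (mulrC _ _) sp); apply: eq_bigr => j _.
rewrite !hornerE -mulrA -exprMn; congr (_ * _ ^+ _).
by field; rewrite gt_eqF.
Qed.

Lemma abs_radius_ge r p : 0 <= r ->
  (forall z : R, - r <= z <= 0 -> forall j, 0 <= (p^`(j)).[z]) ->
  (r%:E <= abs_monotonicity_radius p)%E.
Proof.
move=> r0 pr; rewrite /abs_monotonicity_radius /ereal_sup_or0.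
set A := (X in `[< X = _ >]).
have Ar : A r%:E by exists r.
case: asboolP => [A0|_]; first by rewrite A0 in Ar.
exact: ereal_sup_ubound.
Qed.

Lemma abs_radius_ge0 p : (0 <= abs_monotonicity_radius p)%E.
Proof.
rewrite /abs_monotonicity_radius /ereal_sup_or0.
set A := (X in `[< X = _ >]).
case: asboolP => // /eqP/set0P[x Ax].
apply: le_trans (ereal_sup_ubound Ax).
by case: Ax => r [r0 _] <-; rewrite lee_fin.
Qed.

Lemma lt_abs_radius r p : 0 <= r -> (r%:E < abs_monotonicity_radius p)%E ->
  forall j, 0 <= (p^`(j)).[- r].
Proof.
move=> r0; rewrite /abs_monotonicity_radius /ereal_sup_or0.
case: asboolP => [_|_]; first by rewrite lte_fin ltNge r0.
move=> /ereal_sup_gt[_ [t [t0 pt] <-]]; rewrite lte_fin => rt j.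
by apply: pt; rewrite lerN2 (ltW rt) oppr_le0.
Qed.

End absolute_monotonicity.

(** * The certificate of the upper bound *)

Section threshold_bounds.
Context {R : realType}.
Implicit Types (r : R) (p : {poly R}).

(** The mean of C - kB, as a functional of the coefficients of the stability
function that is multiplied by exp (a z): twice the coefficient of z^2, minus
k times that of z, in the product with [exp_taylor2 a]. *)
Definition moment_defect (k a : R) p : R :=
  2 * p`_2 + 2 * a * p`_1 + a ^+ 2 * p`_0 - k * (p`_1 + a * p`_0).

Lemma moment_defect_sum (k a : R) (I : finType) (g : I -> R)
    (q : I -> {poly R}) :
  moment_defect k a (\sum_i g i *: q i) = \sum_i g i * moment_defect k a (q i).
Proof.
rewrite /moment_defect !coef_sum !mulr_sumr -!big_split/= mulr_sumr -sumrB.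
by apply: eq_bigr => i _; rewrite !coefZ; ring.
Qed.

(** The negative of C - kB at the corner a = k - 1, j = s, times r^2. *)
Definition threshold_poly (k s r : R) : R :=
  (k - 1) * r ^+ 2 - (k - 2) * s * r - s * (s - 1).

(** Since j <= s and a <= k - 1, the quadratic terms j(j-1) and a^2 are at most
j(s-1) and a(k-1). This bounds C - kB by a function that is affine in a and in j
separately, so its sign is read off at the corners: it is 0 at (0, 0), and
negative at every other corner when the threshold polynomial is positive. *)
Lemma moment_defect_neg (s k a j : nat) r : 0 < r -> (j <= s)%N -> (a < k)%N ->
  0 < threshold_poly k%:R s%:R r -> (a + j > 0)%N ->
  moment_defect k%:R a%:R (shifted_power r^-1 j) < 0.
Proof.
move=> r0 js ak T0 aj.
rewrite /moment_defect; have [-> -> ->] := shifted_power_coef r^-1 j.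
have js' : j%:R <= s%:R :> R by rewrite ler_nat.
have ak' : a%:R + 1 <= k%:R :> R by rewrite natr1 ler_nat.
have a0 : 0 <= a%:R :> R by [].
have [j0|j0] := posnP j.
  have a1 : 1 <= a%:R :> R by rewrite ler1n; move: aj; rewrite j0 addn0.
  by rewrite j0; nra.
have j1 : 1 <= j%:R :> R by rewrite ler1n.
set A := a%:R in ak' a0 *; set K := k%:R in ak' T0 *.
set J := j%:R in js' j1 *; set S := s%:R in js' T0 *.
set c := r^-1.
have c0 : 0 < c by rewrite invr_gt0.
have {}T0 : S * (S - 1) * c ^+ 2 < (K - 1) - (K - 2) * (S * c).
  have -> : (K - 1) - (K - 2) * (S * c)
     = threshold_poly K S r * c ^+ 2 + S * (S - 1) * c ^+ 2.
    by rewrite /threshold_poly /c; field; rewrite gt_eqF.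
  by rewrite ltrDr mulr_gt0 ?exprn_gt0.
have P0 : (S - 1) * c - K < 0.
  have [h|h] := leP (1 / 2) (S * c); last by nra.
  have Sc : 0 < S * c by lra.
  by rewrite -(pmulr_llt0 _ Sc); nra.
(* the bound affine in each of A and J *)
have bound : 2 * (J * (J - 1) / 2 * c ^+ 2) + 2 * A * (J * c) + A ^+ 2 * 1
     - K * (J * c + A * 1) <= J * c * ((S - 1) * c - K) + A * (2 * (J * c) - 1).
  rewrite -subr_ge0.
  have -> : J * c * ((S - 1) * c - K) + A * (2 * (J * c) - 1)
    - (2 * (J * (J - 1) / 2 * c ^+ 2) + 2 * A * (J * c) + A ^+ 2 * 1
     - K * (J * c + A * 1)) = J * c ^+ 2 * (S - J) + A * (K - 1 - A) by field.
  apply: addr_ge0; apply: mulr_ge0 => //; try lra.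
  by rewrite mulr_ge0 ?exprn_ge0 ?ltW//; lra.
apply: le_lt_trans bound _.
(* edge A = K - 1: interpolate between the corners J = 0 and J = S *)
have h0 : S * (J * c * ((S - 1) * c - K) + (K - 1) * (2 * (J * c) - 1)) < 0.
  have -> : S * (J * c * ((S - 1) * c - K) + (K - 1) * (2 * (J * c) - 1))
    = J * (S * (S - 1) * c ^+ 2 - ((K - 1) - (K - 2) * (S * c)))
      - (S - J) * (K - 1) by ring.
  have : J * (S * (S - 1) * c ^+ 2 - ((K - 1) - (K - 2) * (S * c))) < 0.
    by rewrite pmulr_rlt0; lra.
  have : 0 <= (S - J) * (K - 1) by rewrite mulr_ge0; lra.
  lra.
have {}h0 : J * c * ((S - 1) * c - K) + (K - 1) * (2 * (J * c) - 1) < 0.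
  by rewrite pmulr_rlt0 in h0 => //; lra.
have P1 : J * c * ((S - 1) * c - K) < 0.
  by rewrite pmulr_rlt0// mulr_gt0//; lra.
have [K1|K1] := eqVneq A 0; first by rewrite K1 mul0r addr0.
have Ap : 0 < A by rewrite lt_def K1.
have Kp : 0 < K - 1 by lra.
rewrite -(pmulr_rlt0 _ Kp).
(* interpolate in A between the edges A = 0 and A = K - 1 *)
have -> : (K - 1) * (J * c * ((S - 1) * c - K) + A * (2 * (J * c) - 1))
  = (K - 1 - A) * (J * c * ((S - 1) * c - K))
   + A * (J * c * ((S - 1) * c - K) + (K - 1) * (2 * (J * c) - 1)) by ring.
have : (K - 1 - A) * (J * c * ((S - 1) * c - K)) <= 0.
  by rewrite mulr_ge0_le0; lra.
have : A * (J * c * ((S - 1) * c - K) + (K - 1) * (2 * (J * c) - 1)) < 0.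
  by rewrite pmulr_rlt0.
lra.
Qed.

Lemma order_conditions2_moment_defect (k : nat) (psi : 'I_k -> {poly R}) :
  order_conditions 2 psi ->
  \sum_(i < k) moment_defect k%:R (k - i.+1)%:R (psi i) = 0.
Proof.
move=> /order_conditions2P h.
have [_ e1 e2] := coef_exp_taylor2 (k%:R : R).
have := h 2 isT; have := h 1 isT; rewrite {}e1 {}e2 !coef_sum => h1 h2.
transitivity (2 * (k%:R ^+ 2 / 2) - k%:R * k%:R : R); last by field.
rewrite -h2 -[X in _ = _ - _ * X]h1 !mulr_sumr -sumrB; apply: eq_bigr => i _.
have [_ -> ->] := coef_mul_exp_taylor2 ((k - i.+1)%:R : R) (psi i).
by rewrite /moment_defect; field.
Qed.

(** A mean of nonpositive values that vanishes forces all the mass onto the zero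
of the certificate, the pair (0, 0). There B = 0, while its mean must be k. *)
Lemma threshold_poly_le0 (s k : nat) (psi : 'I_k -> {poly R}) r :
  (0 < k)%N -> 0 < r -> stability_tuples s 2 psi ->
  (forall i j, 0 <= ((psi i)^`(j)).[- r]) -> threshold_poly k%:R s%:R r <= 0.
Proof.
move=> k0 r0 [psis psi2] psir; rewrite leNgt; apply/negP => T0.
have /choice[g gP] (i : 'I_k) : exists g : 'I_s.+1 -> R, (forall j, 0 <= g j) /\
    psi i = \sum_j g j *: shifted_power r^-1 j.
  by have [g ? ?] := abs_monotone_expansion _ _ _ r0 (psis i) (psir i); exists g.
pose D (i : 'I_k) (j : 'I_s.+1) :=
  moment_defect k%:R (k - i.+1)%:R (shifted_power r^-1 j).
have ak (i : 'I_k) : (k - i.+1 < k)%N by rewrite ltn_subrL.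
have js (j : 'I_s.+1) : (j <= s)%N by rewrite -ltnS.
have D0 (i : 'I_k) (j : 'I_s.+1) : (k - i.+1 + j > 0)%N -> D i j < 0.
  by move=> ij; exact: (moment_defect_neg s).
have gD (i : 'I_k) (j : 'I_s.+1) : 0 <= - (g i j * D i j).
  rewrite -mulrN mulr_ge0 ?(gP i).1// oppr_ge0.
  have [|/D0/ltW//] := posnP (k - i.+1 + j)%N.
  move=> /eqP; rewrite addn_eq0 => /andP[/eqP a0 /eqP j0].
  rewrite /D a0 j0 /moment_defect.
  have [-> -> ->] := shifted_power_coef r^-1 0.
  by rewrite le_eqVlt; apply/orP; left; apply/eqP; ring.
have /eqP : \sum_(i < k) \sum_(j < s.+1) - (g i j * D i j) = 0.
  transitivity (- \sum_(i < k) moment_defect k%:R (k - i.+1)%:R (psi i)).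
    rewrite -sumrN; apply: eq_bigr => i _; rewrite sumrN (gP i).2.
    by rewrite moment_defect_sum.
  by rewrite order_conditions2_moment_defect ?oppr0.
rewrite psumr_eq0; last by move=> i _; exact: sumr_ge0.
move=> /allP g0.
have {}g0 (i : 'I_k) (j : 'I_s.+1) : (k - i.+1 + j > 0)%N -> g i j = 0.
  move=> ij; have := g0 i (mem_index_enum i); rewrite /= psumr_eq0//.
  move=> /allP/(_ j (mem_index_enum j))/=.
  by rewrite oppr_eq0 mulf_eq0 (lt_eqF (D0 i j ij)) orbF => /eqP.
have [_ e1 _] := coef_exp_taylor2 (k%:R : R).
have /order_conditions2P/(_ 1 isT) := psi2; rewrite e1 coef_sum big1.
  by move=> /eqP; rewrite eq_sym pnatr_eq0 gtn_eqF.
move=> i _; have [_ -> _] := coef_mul_exp_taylor2 ((k - i.+1)%:R : R) (psi i).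
rewrite (gP i).2 !coef_sum mulr_sumr -big_split big1// => j _ /=.
rewrite !coefZ; have [-> -> _] := shifted_power_coef r^-1 j.
have [/eqP|/g0 ->] := posnP (k - i.+1 + j)%N; last by rewrite !mul0r mulr0 addr0.
by rewrite addn_eq0 => /andP[/eqP -> /eqP ->]; rewrite !mul0r mulr0 addr0.
Qed.

End threshold_bounds.

(** * The optimal value and an extremal tuple *)

Section optimum.
Context {R : realType}.
Implicit Types k s r : R.

Definition threshold_root k s : R :=
  ((k - 2) * s + Num.sqrt ((k - 2) ^+ 2 * s ^+ 2 + 4 * s * (s - 1) * (k - 1)))
   / (2 * (k - 1)).

Lemma threshold_polyE k s r :
  0 <= (k - 2) ^+ 2 * s ^+ 2 + 4 * s * (s - 1) * (k - 1) -> 1 < k ->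
  threshold_poly k s r = (k - 1) * (r - threshold_root k s)
    * (r + threshold_root k s - (k - 2) * s / (k - 1)).
Proof.
move=> d0 k1; have kn : k - 1 != 0 by rewrite subr_eq0 gt_eqF.
rewrite /threshold_poly /threshold_root; set d := (X in Num.sqrt X).
have := sqr_sqrtr d0; set q := Num.sqrt d => qd.
transitivity (((2 * (k - 1) * r - (k - 2) * s) ^+ 2 - q ^+ 2) / (4 * (k - 1))).
  by rewrite qd /d; field.
by field.
Qed.

Lemma threshold_poly_shift k s r :
  threshold_poly k s r = (r - s) * ((k - 1) * r + s) + s.
Proof. by rewrite /threshold_poly; ring. Qed.

Section extremal.
Variables (s k : nat).
Hypothesis k_gt1 : (1 < k)%N.
Local Notation M := (threshold_root k%:R s%:R).

Let disc_ge0 : 0 <= (k%:R - 2) ^+ 2 * s%:R ^+ 2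
   + 4 * s%:R * (s%:R - 1) * (k%:R - 1) :> R.
Proof.
have k2 : 2 <= k%:R :> R by rewrite ler_nat.
have ss : 0 <= s%:R * (s%:R - 1) :> R.
  by case: s => [|m]; [rewrite mul0r|rewrite mulr_ge0// -natr1 addrK].
apply: addr_ge0; first by rewrite mulr_ge0 ?sqr_ge0.
apply: mulr_ge0; first by rewrite -mulrA mulr_ge0.
lra.
Qed.

Lemma threshold_root_ge0 : 0 <= M.
Proof.
have k2 : 2 <= k%:R :> R by rewrite ler_nat.
apply: divr_ge0; last lra.
by apply: addr_ge0; [apply: mulr_ge0 => //; lra|exact: sqrtr_ge0].
Qed.

Lemma threshold_poly_root : threshold_poly k%:R s%:R M = 0.
Proof.
have k2 : 2 <= k%:R :> R by rewrite ler_nat.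
by rewrite threshold_polyE// ?subrr ?mulr0 ?mul0r//; lra.
Qed.

Lemma threshold_poly_gt0 r : M < r -> 0 < threshold_poly k%:R s%:R r.
Proof.
have k2 : 2 <= k%:R :> R by rewrite ler_nat.
move=> Mr; rewrite threshold_polyE//; last lra.
have sum_roots : (k%:R - 2) * s%:R / (k%:R - 1) <= M + M.
  rewrite /threshold_root; set q := Num.sqrt _.
  have -> : (k%:R - 2) * s%:R / (k%:R - 1) =
    ((k%:R - 2) * s%:R + (k%:R - 2) * s%:R) / (2 * (k%:R - 1)) :> R.
    by field; lra.
  have q0 : 0 <= q by exact: sqrtr_ge0.
  rewrite -[leRHS]mulrDl ler_wpM2r ?invr_ge0; lra.
by apply: mulr_gt0; [apply: mulr_gt0|]; lra.
Qed.

(** The form [threshold_poly_shift] shows that the threshold polynomial is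
positive beyond s. *)
Lemma threshold_root_le : M <= s%:R.
Proof.
have k2 : 2 <= k%:R :> R by rewrite ler_nat.
rewrite leNgt; apply/negP => sM; have := threshold_poly_root.
have s0 : 0 <= s%:R :> R by [].
rewrite threshold_poly_shift; apply/eqP; rewrite gt_eqF//.
by rewrite ltr_wpDr// mulr_gt0; nra.
Qed.

(** The weight that gives B, of value s/M + k - 1 at the pair (k - 1, s) and 0 at
(0, 0), the mean k. *)
Definition extremal_weight : R := k%:R / (s%:R / M + k%:R - 1).
Local Notation w := extremal_weight.

Definition extremal_tuple (i : 'I_k) : {poly R} :=
  if i == 0%N :> nat then w *: shifted_power M^-1 s
  else if i == k.-1 :> nat then (1 - w)%:P else 0.

Hypothesis M0 : 0 < M.

Lemma extremal_weight_bounds : 0 <= w <= 1.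
Proof.
have k2 : 2 <= k%:R :> R by rewrite ler_nat.
have sM : 1 <= s%:R / M by rewrite ler_pdivlMr// mul1r threshold_root_le.
rewrite divr_ge0 ?ler_pdivrMr ?mul1r//; lra.
Qed.

Lemma extremal_order : order_conditions 2 extremal_tuple.
Proof.
have k2 : 2 <= k%:R :> R by rewrite ler_nat.
apply/order_conditions2P => j j3.
have -> : \sum_i extremal_tuple i * exp_taylor2 (k - i.+1)%:R =
   w *: (shifted_power M^-1 s * exp_taylor2 (k%:R - 1))
   + (1 - w) *: (1 * exp_taylor2 0).
  rewrite /extremal_tuple; case: k k_gt1 => [//|[//|n]] _.
  rewrite big_ord_recl big_ord_recr /= big1 => [|i _].
    rewrite add0r /bump /= add1n eqxx subn1 subnn -scalerAl.
    have -> : n.+2%:R - 1 = n.+1%:R :> R by rewrite -natr1 addrK.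
    by rewrite mul1r mul_polyC.
  by rewrite /bump /= add1n eqSS ltn_eqF ?mul0r.
have [e0 e1 e2] := coef_exp_taylor2 (k%:R : R).
rewrite coefD !coefZ.
have [p0 p1 p2] := coef_mul_exp_taylor2 (k%:R - 1) (shifted_power M^-1 s).
have [q0 q1 q2] := coef_mul_exp_taylor2 (0 : R) 1.
have [c0 c1 c2] := shifted_power_coef M^-1 s.
have sM : 1 <= s%:R / M by rewrite ler_pdivlMr// mul1r threshold_root_le.
have wE : w * (s%:R / M + k%:R - 1) = k%:R by rewrite divfK//; lra.
have quad : s%:R * (s%:R - 1) * M^-1 ^+ 2 =
    (k%:R - 1) - (k%:R - 2) * (s%:R / M).
  have h : s%:R * (s%:R - 1) = (k%:R - 1) * M ^+ 2 - (k%:R - 2) * s%:R * M.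
    by apply/eqP; rewrite eq_sym -subr_eq0; apply/eqP; exact: threshold_poly_root.
  by rewrite h; field; rewrite gt_eqF.
case: j j3 => [|[|[|//]]] _.
- by rewrite p0 q0 c0 e0 coef1 /=; ring.
- rewrite p1 q1 c0 c1 e1 !coef1 /=.
  by rewrite -[RHS]wE; ring.
- rewrite p2 q2 c0 c1 c2 e2 !coef1 /=.
  have -> : s%:R * (s%:R - 1) / 2 * M^-1 ^+ 2 =
     ((k%:R - 1) - (k%:R - 2) * (s%:R / M)) / 2.
    by rewrite -quad; field; rewrite gt_eqF.
  transitivity (k%:R * (w * (s%:R / M + k%:R - 1)) / 2).
    by field; rewrite gt_eqF.
  by rewrite wE; field.
Qed.

Lemma extremal_threshold : (M%:E <= threshold_factor extremal_tuple)%E.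
Proof.
have k2 : 2 <= k%:R :> R by rewrite ler_nat.
have /andP[w0 w1] := extremal_weight_bounds.
apply: le_bigmin => [|i _]; first by rewrite leey.
apply: abs_radius_ge => [|z /andP[z1 z2] j]; first exact: ltW.
rewrite /extremal_tuple; case: ifP => _.
  have M1 : 0 <= M^-1 by rewrite invr_ge0 ltW.
  have [a a0 [m am]] := derivn_shifted_power _ s j M1.
  rewrite derivnZ am /shifted_power !hornerE.
  apply: mulr_ge0; [exact: mulr_ge0|apply: exprn_ge0].
  rewrite -[X in X + _](mulVf (lt0r_neq0 M0)) -mulrDr mulr_ge0//.
  by rewrite -lerBlDl sub0r.
case: ifP => _; last by rewrite linear0 horner0.
by rewrite derivnC; case: ifP => _; rewrite hornerC// subr_ge0.
Qed.

End extremal.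
End optimum.

Theorem theorem3 (R : realType) (s k : nat) (hk : (1 < k)%N) :
  optimal_threshold_factor R s k 2 =
  (((k%:R - 2) * s%:R
     + Num.sqrt ((k%:R - 2) ^+ 2 * s%:R ^+ 2
                 + 4 * s%:R * (s%:R - 1) * (k%:R - 1)))
   / (2 * (k%:R - 1)))%:E.
Proof.
rewrite -/(threshold_root k%:R s%:R).
have M0 := @threshold_root_ge0 R s k hk; set M := threshold_root _ _ in M0 *.
rewrite /optimal_threshold_factor /ereal_sup_or0; set A := (X in `[< X = _ >]).
have upper psi : stability_tuples s 2 psi ->
    (@threshold_factor R k psi <= M%:E)%E.
  move=> psiP; rewrite leNgt; apply/negP => Mpsi.
  have [r Mr rpsi] : exists2 r, M < r & (r%:E < threshold_factor psi)%E.
    move: Mpsi; case: threshold_factor => [t|_|//].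
    - by rewrite lte_fin => Mt; exists ((M + t) / 2); rewrite ?lte_fin; lra.
    - by exists (M + 1); rewrite ?ltry// ltrDl.
  have r0 : 0 < r by exact: le_lt_trans Mr.
  have : threshold_poly k%:R s%:R r <= 0.
    apply: (threshold_poly_le0 _ _ psi) => [||//|i]; [exact: ltnW|exact: r0|].
    apply: lt_abs_radius.
      exact: ltW.
    by apply: lt_le_trans rpsi _; exact: bigmin_le.
  by rewrite leNgt threshold_poly_gt0.
have factor_ge0 psi : (0 <= @threshold_factor R k psi)%E.
  by apply: le_bigmin => [|i _]; [rewrite leey|exact: abs_radius_ge0].
have attained : 0 < M -> A (threshold_factor (extremal_tuple s k)).
  move=> Mgt0; exists (extremal_tuple s k) => //; split.
    move=> i; rewrite /extremal_tuple; case: ifP => _.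
      exact: leq_trans (size_scale_leq _ _) (shifted_power_size _ _).
    case: ifP => _; last by rewrite size_poly0.
    exact: leq_trans (size_polyC_leq1 _) _.
  exact: extremal_order.
case: asboolP => [A0|/eqP/set0P[x Ax]].
  congr (_%:E); apply/esym/eqP; rewrite eq_le M0 andbT leNgt.
  by apply/negP => /attained; rewrite A0.
apply/eqP; rewrite eq_le; apply/andP; split.
  by apply: ge_ereal_sup => _ [psi psiP <-]; exact: upper.
have [Mgt0|M_le0] := ltP 0 M.
  apply: le_trans (ereal_sup_ubound (attained Mgt0)).
  exact: extremal_threshold.
apply: le_trans (ereal_sup_ubound Ax); case: Ax => psi _ <-.
by apply: le_trans (factor_ge0 psi); rewrite lee_fin.
Qed.
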